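(* (1) For any ordered instance $I=(n,T,W)$ and any solution $S$ for $I$, the allocation obtained by sorting $S$ is an ordered solution for $I$. (2) For any ordered instance $I=(n,T,W)$, any valid allocation $S$ for $I$, and any strictly increasing sequence of indices $k[1..m]$ in $[1..n]$, the allocation obtained from $S$ by sorting $S[k[1..m]]$ is a valid allocation for $I$.
   Context: Single processor, unit-length tasks. A window is a closed real interval; a slot is a closed real interval of length $1$; intervals overlap iff their interiors intersect. An instance $I=(n,T,W)$ consists of tasks $T[1..n]$ with windows $W[1..n]$. A valid allocation $S$ assigns to each $T[i]$ either a slot $S[i]\subseteq W[i]$ or $S[i]=null$, with no two allocated slots overlapping; a solution allocates every task. Intervals are partially ordered by $X\le Y$ iff $X.\mathrm{start}\le Y.\mathrm{start}$ and $X.\mathrm{end}\le Y.\mathrm{end}$. A sequence of intervals (possibly containing $null$) is ordered iff its non-$null$ elements are increasing in this order. $I$ is ordered iff $W[1..n]$ is ordered; an allocation $S$ is ordered iff $S[1..n]$ is ordered. ''Sort $x[y]$'' for an index sequence $y$ means: permute the non-$null$ entries among the positions $x[y]$ so that $x[y]$ becomes ordered (other positions unchanged); sorting $S$ means sorting $S[1..n]$. *)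

(* Defs.v *)
From HB Require Import structures.
From mathcomp Require Import all_boot all_order all_algebra all_fingroup.
From mathcomp Require Import all_classical all_reals topology normedtype.
Set Implicit Arguments.
Unset Strict Implicit.
Unset Printing Implicit Defensive.
Import Order.TTheory GRing.Theory Num.Theory.
Import numFieldNormedType.Exports.
Local Open Scope classical_set_scope.
Local Open Scope ring_scope.

Record cinterval (R : realType) := CInterval {
  istart : R;
  iend : R;
  istart_le_end : istart <= iend }.

Definition iset (R : realType) (X : cinterval R) : set R :=
  [set` `[istart X, iend X]].

Definition overlap (R : realType) (X Y : cinterval R) : Prop :=
  ((iset X)° `&` (iset Y)°) !=set0.

Definition is_slot (R : realType) (X : cinterval R) : Prop :=
  iend X - istart X = 1.

Definition ile (R : realType) : rel (cinterval R) :=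
  fun X Y => (istart X <= istart Y) && (iend X <= iend Y).

(* [None] plays the role of null; [pmap id] drops the null entries.  "Increasing"
   is in the weak sense, so that repeated windows are allowed. *)
Definition ordered (R : realType) (x : seq (option (cinterval R))) : bool :=
  sorted (@ile R) (pmap id x).

(* Indices are 0-based ('I_n stands for [1..n]).  The tasks themselves are mere
   labels of an arbitrary type: allocations refer to them by their index. *)
Record instance (R : realType) (Task : Type) := Instance {
  ntasks : nat;
  tasks : ntasks.-tuple Task;
  windows : ntasks.-tuple (cinterval R) }.

Definition ordered_instance (R : realType) (Task : Type)
    (I : instance R Task) : bool :=
  ordered [seq Some w | w <- windows I].

Definition allocation (R : realType) (n : nat) : Type :=
  n.-tuple (option (cinterval R)).

Definition valid (R : realType) (Task : Type) (I : instance R Task)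
    (S : allocation R (ntasks I)) : Prop :=
  (forall i X, tnth S i = Some X ->
     is_slot X /\ iset X `<=` iset (tnth (windows I) i)) /\
  (forall i j X Y, i != j -> tnth S i = Some X -> tnth S j = Some Y ->
     ~ overlap X Y).

Definition solution (R : realType) (Task : Type) (I : instance R Task)
    (S : allocation R (ntasks I)) : Prop :=
  valid S /\ forall i, isSome (tnth S i).

(* [sorts_to x y x']: x' is obtained from x by sorting x[y].  The non-null
   entries of x[y] are permuted among the positions they occupy, so null entries
   stay where they are.  This is a relation because intervals are only partially
   ordered: for an arbitrary x a sorted rearrangement need not exist. *)
Definition sorts_to (R : realType) (n : nat) (x : allocation R n)
    (y : seq 'I_n) (x' : allocation R n) : Prop :=
  exists s : 'S_n,
    [/\ perm_on [set i in y | isSome (tnth x i)]%SET s,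
        x' = [tuple tnth x (s i) | i < n]
      & ordered [seq tnth x' i | i <- y]].

Definition sorts_all_to (R : realType) (n : nat) (x x' : allocation R n) : Prop :=
  sorts_to x (enum 'I_n) x'.

(* Main.v *)
Require Import Defs.
From HB Require Import structures.
From mathcomp Require Import all_boot all_order all_algebra all_fingroup.
From mathcomp Require Import all_classical all_reals topology normedtype.
Set Implicit Arguments.
Unset Strict Implicit.
Unset Printing Implicit Defensive.

(** A valid allocation has slots with pairwise distinct starting points, so
    sorting it means sorting the starts, and the result is unique.  Windows are
    respected by a pigeonhole argument: if s is the sorting permutation and i a
    sorted position, then s cannot map all sorted positions [<= i] below i, so
    [i <= s j] for some sorted position [j <= i].  Hence
    start W_i <= start W_(s j) <= start S_(s j) = start S'_j <= start S'_i,
    and dually for the right ends. *)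

Import Order.TTheory GRing.Theory Num.Theory.
Import numFieldNormedType.Exports.
Local Open Scope ring_scope.

(** * Permutations and monotonicity on finite index sets *)

(** Send each [x] to the entry of [q] at the position of [x] in [p]. As [q] lists the same elements
    without repetition, this is an injective self-map of the set of [p], extended by the identity.
    It turns a sorted list of indices into a permutation. *)
Lemma exists_perm_map (T : finType) (p q : seq T) :
  uniq p -> perm_eq p q ->
  exists s : {perm T}, perm_on [set x in p]%SET s /\ map s p = q.
Proof.
move=> Up Epq; have Uq : uniq q by rewrite -(perm_uniq Epq).
have Ep : p =i q by apply: perm_mem.
have szpq : size q = size p by rewrite (perm_size Epq).
pose g x := nth x q (index x p).
have gE : map g p = q.
  rewrite /g; case: (p) Up szpq => [|x0 p'] Up' sz.
    by rewrite (size0nil sz).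
  apply: (@eq_from_nth _ x0); rewrite size_map ?sz // => a ha.
  by rewrite (nth_map x0) // index_uniq //; apply: set_nth_default; rewrite sz.
have gq x : x \in p -> g x \in q.
  by rewrite -gE; apply: map_f.
have injg : {in [set x in p]%SET &, injective g}.
  move=> x y; rewrite !inE => xp yp; rewrite /g (set_nth_default y); last first.
    by rewrite szpq index_mem.
  move/eqP; rewrite nth_uniq ?szpq ?index_mem // => /eqP.
  exact: index_inj.
have subg : g @: [set x in p]%SET \subset [set x in p]%SET.
  apply/fintype.subsetP=> _ /imsetP[x + ->]; rewrite !inE.
  by move/gq; rewrite -Ep.
exists (perm_in injg subg); split; first exact: perm_in_on.
by rewrite -[RHS]gE; apply/eq_in_map=> x xp; rewrite perm_inE ?inE.
Qed.

(** Because [t] is strictly increasing, comparing two of its indices amounts to comparing their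
    positions in [t]. *)
Lemma sorted_map_homo (n : nat) (T : Type) (e : rel T) (g : 'I_n -> T)
    (t : seq 'I_n) :
  reflexive e -> transitive e ->
  sorted (fun i j : 'I_n => (i < j)%N) t -> sorted e (map g t) ->
  {in t &, forall i j : 'I_n, (i <= j)%N -> e (g i) (g j)}.
Proof.
move=> er et; elim: t => [|x t IH] //=.
rewrite path_sortedE; last by move=> ? ? ?; apply: ltn_trans.
rewrite path_sortedE // all_map => /andP[xt st] /andP[gxt sgt] i j.
rewrite !inE => /predU1P[->|it] /predU1P[->|jt] ij; first exact: er.
- exact: (allP gxt).
- by have := allP xt _ it; rewrite ltnNge ij.
- exact: IH.
Qed.

Lemma perm_on_exists_ge (n : nat) (s : 'S_n) (A : {set 'I_n}) (i : 'I_n) :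
  perm_on A s -> i \in A -> exists2 j, j \in A & (j <= i <= s j)%N.
Proof.
move=> sA iA.
case: (boolP [exists j in A, (j <= i <= s j)%N]) => [/exists_inP//|].
rewrite negb_exists_in => /forall_inP noj.
pose B := [set j in A | (j <= i)%N]%SET.
(* Pigeonhole: with no such [j], the injective [s] would map [B] into [B] minus [i], a smaller
   set. *)
have : s @: B \subset B :\ i.
  apply/fintype.subsetP=> _ /imsetP[j + ->]; rewrite !inE => /andP[jA ji].
  have := noj j jA; rewrite ji /= -ltnNge => sji.
  by rewrite perm_closed // jA ltnW // andbT -val_eqE /= neq_ltn sji.
move/subset_leq_card; rewrite card_imset; last exact: perm_inj.
by rewrite (cardsD1 i B) !inE iA leqnn ltnn.
Qed.

(** The previous pigeonhole applied to the inverse permutation. *)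
Lemma perm_on_exists_le (n : nat) (s : 'S_n) (A : {set 'I_n}) (i : 'I_n) :
  perm_on A s -> i \in A -> exists2 j, j \in A & (s j <= i <= j)%N.
Proof.
move=> sA iA.
have sVA : perm_on A s^-1%g by rewrite perm_onV.
have [j jA /andP[ji isj]] := perm_on_exists_ge sVA iA.
by exists (s^-1%g j); rewrite ?perm_closed // permKV ji.
Qed.

(** * Order and overlap of slots *)

Section Sorting.
Variables (R : realType).
Implicit Types (X Y : cinterval R).

Lemma cinterval_eq X Y : istart X = istart Y -> iend X = iend Y -> X = Y.
Proof.
case: X Y => [a b ab] [c d cd] /= ac bd; subst.
by congr CInterval; apply: bool_irrelevance.
Qed.

Lemma ile_refl : reflexive (@ile R).
Proof. by move=> X; rewrite /ile !lexx. Qed.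

Lemma ile_trans : transitive (@ile R).
Proof.
move=> Y X Z /andP[sXY eXY] /andP[sYZ eYZ].
by rewrite /ile (le_trans sXY) ?(le_trans eXY).
Qed.

Lemma slot_end X : is_slot X -> iend X = istart X + 1.
Proof. by move=> <-; rewrite addrC subrK. Qed.

Lemma ile_slot X Y : is_slot X -> is_slot Y -> ile X Y = (istart X <= istart Y).
Proof. by move=> /slot_end eX /slot_end eY; rewrite /ile eX eY lerD2r andbb. Qed.

(** Unit length makes the interior nonempty: it contains the midpoint. Hence a valid allocation
    cannot use one slot twice. *)
Lemma overlap_slotxx X : is_slot X -> overlap X X.
Proof.
move=> /slot_end eX; exists ((istart X + iend X) / 2).
have lt : istart X < iend X by rewrite eX ltrDl.
by split; rewrite /iset interior_itv_bnd /= in_itv /= !midf_lt.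
Qed.

Lemma iset_subset X Y :
  (iset X `<=` iset Y)%classic <->
  istart Y <= istart X /\ iend X <= iend Y.
Proof.
split=> [sXY|[sYX eXY] x].
  have /sXY : iset X (istart X) by rewrite /iset /= in_itv /= lexx istart_le_end.
  have /sXY : iset X (iend X) by rewrite /iset /= in_itv /= lexx istart_le_end.
  by rewrite /iset /= !in_itv /= => /andP[_ ->] /andP[-> _].
rewrite /iset /= !in_itv /= => /andP[sx xe].
by rewrite (le_trans sYX) ?(le_trans xe).
Qed.

(** * Sorting an allocation as sorting real starting points *)

Section Allocation.
Variables (n : nat) (S : allocation R n).

Definition permuted (s : 'S_n) : allocation R n := [tuple tnth S (s i) | i < n].

(** The value 0 at null entries is a placeholder that makes the function total; starts are compared
    at occupied positions only. *)
Definition slot_start (i : 'I_n) : R := oapp (@istart R) 0 (tnth S i).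

Definition occupied (y : seq 'I_n) : seq 'I_n :=
  [seq i <- y | isSome (tnth S i)].

Lemma mem_occupied y i : (i \in occupied y) = isSome (tnth S i) && (i \in y).
Proof. by rewrite mem_filter. Qed.

Lemma occupied_set y :
  [set i in y | isSome (tnth S i)]%SET = [set i in occupied y]%SET.
Proof. by apply/setP=> i; rewrite !inE mem_occupied andbC. Qed.

(** Such an [s] permutes the occupied positions of [y] and fixes all others, so the null pattern is
    preserved. *)
Lemma isSome_perm_on y (s : 'S_n) i :
  perm_on [set i in occupied y]%SET s ->
  isSome (tnth S (s i)) = isSome (tnth S i).
Proof.
move=> sy; have := perm_closed i sy; rewrite !inE.
case: (boolP (i \in occupied y)) => iy.
  by move: iy; rewrite !mem_occupied => /andP[-> _] /andP[-> _].
by rewrite (out_perm sy) // inE.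
Qed.

Lemma map_occupied_perm_eq y (s : 'S_n) :
  uniq y -> perm_on [set i in occupied y]%SET s ->
  perm_eq (map s (occupied y)) (occupied y).
Proof.
move=> Uy sy; apply: uniq_perm; rewrite ?map_inj_uniq ?filter_uniq //.
  exact: perm_inj.
move=> i; rewrite -{1}(permKV s i) mem_map; last exact: perm_inj.
by have := perm_closed (s^-1%g i) sy; rewrite !inE permKV => ->.
Qed.

Hypothesis slots : forall i X, tnth S i = Some X -> is_slot X.

(** Slots all have length 1, so on them the partial order on intervals reduces to the total order on
    starts. *)
Lemma sorted_ile_pmap t :
  all (fun i => isSome (tnth S i)) t ->
  sorted (@ile R) (pmap (tnth S) t) = sorted <=%R (map slot_start t).
Proof.
case: t => //= i t; case Si: (tnth S i) => [X|] //= allt.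
elim: t i X Si allt => //= j t IH i X Si.
case Sj: (tnth S j) => [Y|] //= allt.
rewrite (IH j Y) // ile_slot; [|exact: slots Si|exact: slots Sj].
by rewrite /slot_start Si Sj.
Qed.

Lemma ordered_permuted y (s : 'S_n) :
  perm_on [set i in occupied y]%SET s ->
  ordered [seq tnth (permuted s) i | i <- y] =
  sorted <=%R (map slot_start (map s (occupied y))).
Proof.
move=> sy; rewrite -sorted_ile_pmap; last first.
  apply/allP=> _ /mapP[i + ->]; rewrite (isSome_perm_on _ sy) mem_occupied.
  by case/andP.
rewrite /ordered /occupied; congr sorted.
(* Only the preserved null pattern is kept, as [sy] depends on the [y] of the induction. *)
have Ss i := isSome_perm_on i sy.
elim: y {sy} => //= i y IH.
have := Ss i; rewrite tnth_mktuple.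
by case: (tnth S i) => [X|] /=; case Ssi: (tnth S (s i)) => [Z|] //= _;
  rewrite ?Ssi /= IH.
Qed.

Lemma sorts_toP y S' :
  sorts_to S y S' <->
  exists s : 'S_n, [/\ perm_on [set i in occupied y]%SET s, S' = permuted s
    & sorted <=%R (map slot_start (map s (occupied y)))].
Proof.
rewrite /sorts_to occupied_set.
by split=> -[s [sy -> so]]; exists s; split; rewrite // -?ordered_permuted //;
  rewrite ordered_permuted.
Qed.

Hypothesis disj : forall i j X Y,
  i != j -> tnth S i = Some X -> tnth S j = Some Y -> ~ overlap X Y.

(** Equal starts force equal slots, and a slot overlaps itself, against disjointness. *)
Lemma slot_start_inj y : {in occupied y &, injective slot_start}.
Proof.
move=> i j; rewrite !mem_occupied /slot_start.
case Si: (tnth S i) => [X|] //= _; case Sj: (tnth S j) => [Y|] //= _ eXY.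
apply/eqP/negP=> /negP nij; apply: (disj nij Si Sj).
rewrite (@cinterval_eq X Y) //; first exact/overlap_slotxx/(slots Sj).
by rewrite (slot_end (slots Si)) (slot_end (slots Sj)) eXY.
Qed.

Lemma sorts_to_exists_unique y : uniq y -> exists! S', sorts_to S y S'.
Proof.
move=> Uy; have Uo : uniq (occupied y) by rewrite filter_uniq.
pose t := sort (relpre slot_start <=%R) (occupied y).
have [s [sy st]] : exists s : 'S_n,
    perm_on [set i in occupied y]%SET s /\ map s (occupied y) = t.
  by apply: exists_perm_map => //; rewrite perm_sym perm_sort.
have so : sorted <=%R (map slot_start (map s (occupied y))).
  by rewrite st sorted_map sort_sorted // => i j; apply: le_total.
exists (permuted s); split; first by apply/sorts_toP; exists s.
move=> _ /sorts_toP[s' [s'y -> s'o]]; congr permuted.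
(* Uniqueness: both lists of starts are sorted rearrangements of the same list of reals, hence
   equal; injectivity of starts then recovers the permutation. *)
have /eqP : map slot_start (map s (occupied y)) =
            map slot_start (map s' (occupied y)).
  apply: le_sorted_eq => //; apply: perm_map.
  rewrite (perm_trans (map_occupied_perm_eq Uy sy)) // perm_sym.
  exact: map_occupied_perm_eq.
rewrite -!map_comp => /eqP/eq_in_map ess'.
apply/permP=> i; case: (boolP (i \in occupied y)) => iy; last first.
  by rewrite !(@out_perm _ [set i in occupied y]%SET) // inE.
apply: (@slot_start_inj y); last exact: ess'.
  by have := perm_closed i sy; rewrite !inE iy.
by have := perm_closed i s'y; rewrite !inE iy.
Qed.

End Allocation.

(** * Validity of the sorted allocation *)

Lemma ordered_windows (Task : Type) (I : instance R Task)
    (i j : 'I_(ntasks I)) :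
  ordered_instance I -> (i <= j)%N ->
  ile (tnth (windows I) i) (tnth (windows I) j).
Proof.
rewrite /ordered_instance /ordered map_pK // => sW ij.
pose X0 := tnth (windows I) i; rewrite !(tnth_nth X0).
apply: (sorted_leq_nth ile_trans ile_refl) => //.
  by rewrite inE size_tuple ltn_ord.
by rewrite inE size_tuple ltn_ord.
Qed.

Lemma sorts_to_valid (Task : Type) (I : instance R Task)
    (S S' : allocation R (ntasks I)) (y : seq 'I_(ntasks I)) :
  ordered_instance I -> valid S ->
  sorted (fun i j : 'I_(ntasks I) => (i < j)%N) y ->
  sorts_to S y S' -> valid S'.
Proof.
move=> oI [slotW disj] sy.
have slots i X : tnth S i = Some X -> is_slot X by case/slotW.
case/(sorts_toP slots)=> s [sP -> so].
(* Disjointness is inherited because [s] sends distinct positions to distinct positions. *)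
split; last first.
  move=> i j X Y nij; rewrite !tnth_mktuple; apply: disj.
  by rewrite (inj_eq perm_inj).
move=> i X; rewrite tnth_mktuple => SiX; split; first exact: slots SiX.
(* A position outside the sorted ones keeps its slot, and so its window bound. *)
case: (boolP (i \in occupied S y)) => iy; last first.
  by move: SiX; rewrite (out_perm sP) ?inE // => /slotW[].
have sty : sorted (fun i j : 'I_(ntasks I) => (i < j)%N) (occupied S y).
  by apply: sorted_filter => // ? ? ?; apply: ltn_trans.
rewrite -map_comp in so.
have homo := sorted_map_homo (@lexx _ R) (@le_trans _ R) sty so.
have slot_at j : j \in occupied S y ->
    exists2 Y, tnth S (s j) = Some Y & slot_start S (s j) = istart Y.
  rewrite mem_occupied -(isSome_perm_on _ sP) /slot_start => /andP[+ _].
  by case: (tnth S (s j)) => // Y _; exists Y.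
have fi : slot_start S (s i) = istart X by rewrite /slot_start SiX.
have iA : i \in [set i in occupied S y]%SET by rewrite inE.
apply/iset_subset; split.
  have [j + /andP[ji isj]] := perm_on_exists_ge sP iA; rewrite inE => jy.
  have [Y SY fY] := slot_at j jy.
  have [_ /iset_subset[WY _]] := slotW _ _ SY.
  have /andP[Wi _] := ordered_windows oI isj.
  have := homo j i jy iy ji; rewrite /= fY fi => YX.
  exact: le_trans Wi (le_trans WY YX).
have [j + /andP[sji ij]] := perm_on_exists_le sP iA; rewrite inE => jy.
have [Y SY fY] := slot_at j jy.
have [sY /iset_subset[_ WY]] := slotW _ _ SY.
have /andP[_ Wi] := ordered_windows oI sji.
have := homo i j iy jy ij; rewrite /= fY fi => XY.
apply: le_trans (le_trans WY Wi).
(* Monotonicity is known for starts; unit length carries it over to ends. *)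
by rewrite (slot_end (slots _ _ SiX)) (slot_end sY) lerD2r.
Qed.

End Sorting.

Lemma enum_ord_sorted (n : nat) :
  sorted (fun i j : 'I_n => (i < j)%N) (enum 'I_n).
Proof.
by have := iota_ltn_sorted 0 n; rewrite -val_enum_ord sorted_map.
Qed.

Theorem mainTheorem3 (R : realType) (Task : Type) :
  (forall (I : instance R Task) (S : allocation R (ntasks I)),
     ordered_instance I -> solution S ->
     (exists! S', sorts_all_to S S') /\
     (forall S', sorts_all_to S S' -> solution S' /\ ordered S'))
  /\
  (forall (I : instance R Task) (S : allocation R (ntasks I))
      (m : nat) (k : m.-tuple 'I_(ntasks I)),
     ordered_instance I -> valid S ->
     sorted (fun i j : 'I_(ntasks I) => (i < j)%N) k ->
     (exists! S', sorts_to S k S') /\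
     (forall S', sorts_to S k S' -> valid S')).
Proof.
have uniq_sorted (I : instance R Task) (S : allocation R (ntasks I)) y :
    valid S -> uniq y -> exists! S', sorts_to S y S'.
  move=> [slotW disj]; apply: sorts_to_exists_unique => //.
  by move=> i X /slotW[].
split=> [I S oI [vS allS]|I S m k oI vS sk].
  split=> [|S' S'P]; first by apply: uniq_sorted; rewrite ?enum_uniq.
  split.
    split; first exact: sorts_to_valid oI vS (enum_ord_sorted _) S'P.
    by case: S'P => s [_ -> _] i; rewrite tnth_mktuple.
  (* Reading [S'] along all indices gives [S'] itself. *)
  by case: S'P => s [_ _]; rewrite map_tnth_enum.
split=> [|S']; last exact: sorts_to_valid.
apply: uniq_sorted => //; apply: sorted_uniq sk.
  by move=> ? ? ?; apply: ltn_trans.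
by move=> i; rewrite ltnn.
Qed.
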